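(* Let $\lambda>0$. For each $N\in\mathbb{N}$ let $w^{(N)}=(w_1^{(N)},\dots,w_N^{(N)})$ and $p^{(N)}=(p_1^{(N)},\dots,p_N^{(N)})$ be probability vectors with strictly positive entries, and assume the weights are diffuse, i.e. $\max_{1\le i\le N}w_i^{(N)}\to0$ as $N\to\infty$. Fix $\theta\in(0,1)$ and suppose there exist positive scales $(a_N)_{N\in\mathbb{N}}$ and a continuous, strictly increasing function $F:[0,\infty)\to[0,1)$ with $F(0)=0$ and $\lim_{\alpha\to\infty}F(\alpha)=1$ such that for every $\alpha\ge0$, \[ m_N(a_N\alpha)\longrightarrow F(\alpha)\quad\text{as }N\to\infty, \] where $m_N$ is the mean profile. Let $\alpha_\theta$ be the unique solution of $F(\alpha_\theta)=\theta$. Then the quorum time $\tau_{N,\theta}$ satisfies \[ \frac{\tau_{N,\theta}}{a_N}\longrightarrow\alpha_\theta\quad\text{in probability as }N\to\infty. \]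
   Context: For each $N$, let $T_1,\dots,T_N$ (depending on $N$) be independent with $T_i\sim\mathrm{Exp}(\lambda p_i^{(N)})$ (rate $\lambda p_i^{(N)}$). Discovered-mass process: $M_N(t)=\sum_{i=1}^N w_i^{(N)}\mathbf{1}_{\{T_i\le t\}}$. Mean profile: $m_N(t)=\mathbb{E}[M_N(t)]=\sum_{i=1}^N w_i^{(N)}(1-e^{-\lambda p_i^{(N)} t})$. Quorum time: $\tau_{N,\theta}=\inf\{t\ge0:M_N(t)>\theta\}$. *)

(* Defs.v *)
From HB Require Import structures.
From mathcomp Require Import all_boot all_order all_algebra.
From mathcomp Require Import all_classical all_reals all_analysis.
Set Implicit Arguments.
Unset Strict Implicit.
Unset Printing Implicit Defensive.
Import Order.TTheory GRing.Theory Num.Theory.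
Import numFieldNormedType.Exports.
Local Open Scope classical_set_scope.
Local Open Scope ring_scope.

Definition positive_prob_vector (R : realType) (n : nat) (v : 'I_n -> R) : Prop :=
  (forall i, 0 < v i) /\ \sum_(i < n) v i = 1.

Definition mutually_independent (d : measure_display) (Omega : measurableType d)
    (R : realType) (P : probability Omega R) (I : finType)
    (X : I -> {RV P >-> R}) : Prop :=
  forall (J : {set I}) (B : I -> set R), (forall i, measurable (B i)) ->
    P (\bigcap_(i in [set i | i \in J]) (X i @^-1` B i)) =
    (\prod_(i in J) P (X i @^-1` B i))%E.

Definition has_exponential_law (d : measure_display) (Omega : measurableType d)
    (R : realType) (P : probability Omega R) (rate : R)
    (X : {RV P >-> R}) : Prop :=
  forall A : set R, measurable A -> distribution P X A = exponential_prob rate A.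

Definition discovered_mass (R : realType) (Omega : Type) (n : nat)
    (w : 'I_n -> R) (T : 'I_n -> Omega -> R) (t : R) (omega : Omega) : R :=
  \sum_(i < n) w i * \1_[set x | T i x <= t] omega.

Definition mean_profile (d : measure_display) (Omega : measurableType d)
    (R : realType) (P : probability Omega R) (n : nat)
    (w : 'I_n -> R) (T : 'I_n -> {RV P >-> R}) (t : R) : \bar R :=
  'E_P[discovered_mass w T t].

(* [inf] is the real infimum, which is 0 on sets without one.  This default is
   never reached when the weights sum to 1 and theta < 1: the T_i are
   finite-valued, so the set below contains every t >= 0 above all of them. *)
Definition quorum_time (R : realType) (Omega : Type) (n : nat)
    (w : 'I_n -> R) (T : 'I_n -> Omega -> R) (theta : R) (omega : Omega) : R :=
  inf [set t : R | 0 <= t /\ theta < discovered_mass w T t omega].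

(* Convergence in probability to a constant; the probability space may vary
   with N.  Meant for measurable X N. *)
Definition cvg_in_probability (R : realType) (d : nat -> measure_display)
    (Omega : forall N, measurableType (d N))
    (P : forall N, probability (Omega N) R)
    (X : forall N, Omega N -> R) (l : R) : Prop :=
  forall eps : R, 0 < eps ->
    P N [set omega | eps < `|X N omega - l|] @[N --> \oo] --> 0%E.

(* Main.v *)
Require Import Defs.
From HB Require Import structures.
From mathcomp Require Import all_boot all_order all_algebra.
From mathcomp Require Import all_classical all_reals all_analysis.
From mathcomp Require Import measurable_realfun.
From mathcomp Require Import lra.
Set Implicit Arguments.
Unset Strict Implicit.
Unset Printing Implicit Defensive.
Import Order.TTheory GRing.Theory Num.Theory.
Import numFieldNormedType.Exports.
Local Open Scope classical_set_scope.
Local Open Scope ring_scope.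

(** By pairwise independence, the variance of M_N(t) is at most
    sum_i w_i^2 <= max_i w_i, uniformly in t, so Chebyshev's inequality gives
    M_N(a_N alpha) -> F(alpha) in probability for every alpha >= 0.  Since M_N
    is a right-continuous step function of t, tau <= t iff theta < M_N(t);
    hence |tau / a_N - alpha_theta| > eps forces M_N(a_N alpha) to be on the
    wrong side of theta, hence far from F(alpha), at one of the two points
    alpha = alpha_theta + eps and alpha = max(0, alpha_theta - eps). *)

(** * Indicators in L^r and the variance of uncorrelated sums *)

Lemma Lfun_indic d (T : measurableType d) (R : realType)
    (mu : {finite_measure set T -> \bar R}) (A : set T) (r : R) :
  1 <= r -> measurable A -> \1_A \in Lfun mu r%:E.
Proof.
move=> r1 mA; rewrite inE/=; apply/andP; split.
  by rewrite inE/=; exact: measurable_indic.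
rewrite inE/= /finite_norm unlock /Lnorm poweR_lty//.
under eq_integral => x _ /=.
  rewrite (_ : `|\1_A x| `^ r = \1_A x); first over.
  rewrite indicE; case: (x \in A); rewrite /= ?normr1 ?powR1// normr0 powR0//.
  by rewrite gt_eqF// (lt_le_trans ltr01).
by rewrite integral_indic// setIT; rewrite ltey_eq fin_num_measure.
Qed.

Section variance_sum.
Context d (T : measurableType d) (R : realType) (P : probability T R).
Local Open Scope ereal_scope.

Lemma Lfun2_sum (I : Type) (s : seq I) (X : I -> T -> R) :
  (forall i, X i \in Lfun P 2%:E) -> (\sum_(i <- s) X i)%R \in Lfun P 2%:E.
Proof. by move=> X2; rewrite rpred_sum// lee1n. Qed.

Lemma covariance_sumr (I : Type) (s : seq I) (X : I -> T -> R) (Y : T -> R) :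
  (forall i, X i \in Lfun P 2%:E) -> Y \in Lfun P 2%:E ->
  covariance P Y (\sum_(i <- s) X i)%R = \sum_(i <- s) covariance P Y (X i).
Proof.
move=> X2 Y2; elim: s => [|i s IH].
  by rewrite !big_nil covariance_cst_r.
by rewrite !big_cons -IH covarianceDr ?Lfun2_sum.
Qed.

(** Induction on [s]: at each step the cross term vanishes by bilinearity of the covariance.
    Uncorrelatedness concerns distinct indices only, hence [uniq s]. *)
Lemma variance_sum (I : eqType) (s : seq I) (X : I -> T -> R) :
  uniq s -> (forall i, X i \in Lfun P 2%:E) ->
  (forall i j, i != j -> covariance P (X i) (X j) = 0) ->
  'V_P[(\sum_(i <- s) X i)%R] = \sum_(i <- s) 'V_P[X i].
Proof.
move=> + X2 X0; elim: s => [_|i s IH /= /andP[si us]].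
  by rewrite !big_nil variance_cst.
have C0 : covariance P (X i) (\sum_(j <- s) X j)%R = 0.
  rewrite covariance_sumr// big_seq big1// => j js; apply: X0.
  by apply: contraNneq si => ->.
by rewrite !big_cons -IH// varianceD ?Lfun2_sum// C0 mule0 adde0.
Qed.

(** Serves twice: for independent events the value is 0, and for [A = B] it is the variance of an
    indicator. *)
Lemma covariance_indic (A B : set T) : measurable A -> measurable B ->
  covariance P \1_A \1_B = P (A `&` B) - P A * P B.
Proof.
move=> mA mB; have AB : (\1_A * \1_B = \1_(A `&` B) :> (T -> R))%R.
  by rewrite indicI.
rewrite covarianceE ?AB ?Lfun_indic//; last exact: measurableI.
by rewrite !expectation_indic//; exact: measurableI.
Qed.

End variance_sum.

(** * Inversion of the quorum time *)

Section quorum_time.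
Context (R : realType) (Omega : Type) (n : nat).
Context (w : 'I_n -> R) (T : 'I_n -> Omega -> R).
Context (hw : positive_prob_vector w).

Lemma discovered_massE (t : R) (x : Omega) :
  discovered_mass w T t x = \sum_(i < n | T i x <= t) w i.
Proof.
rewrite big_mkcond; apply: eq_bigr => i _; rewrite indicE.
case: ifPn => Tt; first by rewrite mem_set// mulr1.
by rewrite memNset ?mulr0//; exact/negP.
Qed.

(** Comparing arrivals instead of assuming [s <= t] also covers [s > t] with no arrival in between,
    the case needed for right-continuity. *)
Lemma le_discovered_mass (s t : R) (x : Omega) :
  (forall i, T i x <= s -> T i x <= t) ->
  discovered_mass w T s x <= discovered_mass w T t x.
Proof.
move=> st; rewrite !discovered_massE [leRHS]big_mkcond [leLHS]big_mkcond.
apply: ler_sum => i _; case: ifPn => [/st ->//|_].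
by case: ifP => // _; exact/ltW/hw.1.
Qed.

(* [M] is constant on a right neighbourhood of [t], so the infimum defining
   the quorum time is attained. *)
Lemma quorum_time_le (theta t : R) (x : Omega) : theta < 1 -> 0 <= t ->
  (quorum_time w T theta x <= t) = (theta < discovered_mass w T t x).
Proof.
move=> theta1 t0; apply/idP/idP => [qt|Mt]; last first.
  by apply: ge_inf => //; exists 0 => s [].
apply: contrapT => Mt.
(* The first arrival after [t]; the default [t + 1] keeps [t < u] when there is none. *)
pose u := \big[Num.min/t + 1]_(i < n | t < T i x) T i x.
have tu : t < u by apply/bigmin_gtP; split; rewrite ?ltrDl.
have [|s [_ Ms] su] := inf_lt _ (le_lt_trans qt tu).
  (* The set is nonempty: at the last arrival time all the mass, 1 > [theta], has been
     discovered. *)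
  exists (\big[Num.max/0]_(i < n) T i x); split.
    exact: bigmax_ge_id.
  rewrite discovered_massE (eq_bigl xpredT) ?hw.2// => i.
  exact: le_bigmax.
apply: Mt; apply: (lt_le_trans Ms).
(* Since [s < u], every arrival up to [s] has already occurred by [t]. *)
apply: le_discovered_mass => i Tis; rewrite leNgt; apply/negP => tTi.
by move: (le_lt_trans Tis su); rewrite ltNge bigmin_le_cond.
Qed.

Lemma quorum_time_ge0 (theta : R) (x : Omega) : 0 <= quorum_time w T theta x.
Proof.
rewrite /quorum_time; set S := [set _ | _].
have [->|S0] := eqVneq S set0; first by rewrite inf0.
by apply: lb_le_inf => [|s []//]; exact/set0P.
Qed.

End quorum_time.

(** * Measurability of the discovered mass and of the quorum time *)

Section measurability.
Context d (Omega : measurableType d) (R : realType) (P : probability Omega R).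
Context (n : nat) (w : 'I_n -> R) (T : 'I_n -> {RV P >-> R}).

Lemma measurable_discovered_mass (t : R) :
  measurable_fun setT (discovered_mass w T t).
Proof.
apply: measurable_sum => i; apply: measurable_funM => //.
apply: measurable_indic.
rewrite (_ : [set x | _] = T i @^-1` `]-oo, t]); first exact: measurable_funPTI.
by apply/seteqP; split => x /=; rewrite in_itv.
Qed.

Lemma measurable_quorum_time (theta : R) : positive_prob_vector w -> theta < 1 ->
  measurable_fun setT (quorum_time w T theta).
Proof.
move=> hw theta1; apply: (measurability _ (RGenOInfty.measurableE R)).
(* The rays []t, +oo[] generate the Borel sets. Their preimages are {M(t) <= [theta]} for [t >= 0]
   and the whole space for [t < 0]. *)
move=> _ [_ [t ->] <-]; rewrite setTI.
have [t0|t0] := leP 0 t.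
  rewrite (_ : _ @^-1` _ = discovered_mass w T t @^-1` `]-oo, theta]).
    rewrite -[X in measurable X]setTI.
    exact: measurable_discovered_mass.
  apply/seteqP; split => x /=; rewrite !in_itv/= andbT.
    by rewrite ltNge quorum_time_le// -leNgt.
  by rewrite ltNge quorum_time_le// -leNgt.
rewrite (_ : _ @^-1` _ = setT)//; apply/seteqP; split => x //= _.
by rewrite in_itv/= andbT (lt_le_trans t0)// quorum_time_ge0.
Qed.

End measurability.

(** * Variance bound and Chebyshev's inequality *)

Section concentration.
Context d (Omega : measurableType d) (R : realType) (P : probability Omega R).
Context (n : nat) (w : 'I_n -> R) (T : 'I_n -> {RV P >-> R}).
Context (hw : positive_prob_vector w) (hT : mutually_independent T).

Lemma mutually_independent_pair (i j : 'I_n) (A : set R) :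
  i != j -> measurable A ->
  P (T i @^-1` A `&` T j @^-1` A) = (P (T i @^-1` A) * P (T j @^-1` A))%E.
Proof.
move=> ij mA; have := hT [set i; j]%SET (fun=> mA).
rewrite big_setU1/= ?inE// big_set1 => <-; congr (P _).
apply/seteqP; split => x /=.
  by move=> [xi xj] k /=; rewrite !inE => /orP[] /eqP ->.
by move=> Tx; split; apply: Tx; rewrite /= !inE eqxx// orbT.
Qed.

Lemma variance_discovered_mass_le (t : R) :
  ('V_P[discovered_mass w T t] <= (\big[Num.max/0]_(i < n) w i)%:E)%E.
Proof.
pose A i := T i @^-1` `]-oo, t].
have mA i : measurable (A i) by exact: measurable_funPTI.
have A2 i : (\1_(A i) : Omega -> R) \in Lfun P 2%:E.
  by rewrite Lfun_indic// ler1n.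
have A1 i : (\1_(A i) : Omega -> R) \in Lfun P 1 by rewrite Lfun_indic.
have AA1 i j : (\1_(A i) * \1_(A j) : Omega -> R)%R \in Lfun P 1.
  exact: Lfun2_mul_Lfun1.
have X2 i : (w i \o* \1_(A i) : Omega -> R) \in Lfun P 2%:E.
  by rewrite Lfun_scale// ler1n.
have -> : discovered_mass w T t = \sum_(i < n) (w i \o* \1_(A i) : Omega -> R).
  apply/funext => x; rewrite fct_sumE; apply: eq_bigr => i _ /=.
  by rewrite mulrC (_ : [set y | _] = A i)//.
rewrite variance_sum//; last 2 first.
- exact: index_enum_uniq.
- move=> i j ij; rewrite covarianceZl//; last 2 first.
  + exact: Lfun_subset12 (fin_num_measure P _ measurableT) _ (X2 j).
  + exact: Lfun2_mul_Lfun1.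
  rewrite covarianceZr// covariance_indic//.
  have -> : P (A i `&` A j) = (P (A i) * P (A j))%E.
    exact: mutually_independent_pair.
  by rewrite subee ?mule0// fin_numM// fin_num_measure.
(* One factor of w_i^2 is bounded by the maximum; the other is kept, since the weights sum to 1. *)
apply: (@le_trans _ _ (\sum_(i < n) (w i * \big[Num.max/0]_(i < n) w i)%:E)%E).
  apply: lee_sum => i _; rewrite varianceZ// /variance covariance_indic// setIid.
  rewrite -(fineK (fin_num_measure P _ (mA i))) -EFinM lee_fin.
  rewrite expr2 -mulrA ler_wpM2l//; first exact/ltW/hw.1.
  apply: le_trans (le_bigmax _ _ i); rewrite ler_piMr//; first exact/ltW/hw.1.
  rewrite lerBlDr (@le_trans _ _ 1)// ?lerDl ?mulr_ge0 ?fine_ge0//.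
  by rewrite -lee_fin fineK ?fin_num_measure// probability_le1.
by rewrite sumEFin -mulr_suml hw.2 mul1r.
Qed.

Lemma discovered_mass_chebyshev (t eps : R) : 0 < eps ->
  (P [set x | (eps <= `|discovered_mass w T t x
                        - fine (mean_profile w T t)|)%R]
   <= (eps ^- 2 * \big[Num.max/0]_(i < n) w i)%:E)%E.
Proof.
move=> eps0.
pose X : {RV P >-> R} := mfun_Sub (mem_set (measurable_discovered_mass w T t)).
apply: (le_trans (@chebyshev _ _ _ _ X _ eps0)).
rewrite EFinM lee_wpmul2l ?lee_fin ?invr_ge0 ?exprn_ge0 ?(ltW eps0)//.
exact: variance_discovered_mass_le.
Qed.

End concentration.

(** * Convergence in probability *)

(** The flag [b] covers both the non-strict event of Chebyshev's inequality and the strict one of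
    [cvg_in_probability]. *)
Lemma measurable_superlevel d (T : measurableType d) (R : realType)
    (f : T -> R) (b : bool) (e : R) : measurable_fun setT f ->
  measurable [set x | if b then e <= f x else e < f x].
Proof.
move=> mf; rewrite (_ : [set x | _] =
    f @^-1` [set` Interval (BSide b e) (BInfty R false)]).
  by rewrite -[X in measurable X]setTI; exact: mf.
by apply/seteqP; split => x /=; rewrite in_itv /= andbT; case: b.
Qed.

Lemma measurable_fun_dist d (T : measurableType d) (R : realType)
    (f : T -> R) (c : R) : measurable_fun setT f ->
  measurable_fun setT (fun x => `|f x - c|).
Proof.
by move=> mf; apply: measurableT_comp => //; exact: measurable_funB.
Qed.

Lemma discovered_mass_cvg_probability (R : realType) (w : forall N : nat, 'I_N -> R)
    (d : nat -> measure_display) (Omega : forall N, measurableType (d N))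
    (P : forall N, probability (Omega N) R) (T : forall N, 'I_N -> {RV P N >-> R})
    (t : nat -> R) (m : R) :
  (forall N, (0 < N)%N -> positive_prob_vector (w N)) ->
  (forall N, (0 < N)%N -> mutually_independent (T N)) ->
  \big[Num.max/0]_(i < N) w N i @[N --> \oo] --> (0 : R) ->
  mean_profile (w N) (T N) (t N) @[N --> \oo] --> m%:E ->
  cvg_in_probability P (fun N => discovered_mass (w N) (T N) (t N)) m.
Proof.
move=> hw hindep hdiffuse /fine_cvgP[_ tm] eps eps0.
(* Half of [eps] is for the deviation of the mass from its mean, half for the distance from the mean
   to [m]. *)
have eps20 : 0 < eps / 2 by rewrite divr_gt0.
pose b N := ((eps / 2) ^- 2 * \big[Num.max/0]_(i < N) w N i)%:E.
apply: (@squeeze_cvge _ _ _ _ (cst 0%E) _ b); last 2 first.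
- exact: cvg_cst.
- apply: cvg_EFin; first exact: nearW.
  by rewrite -[X in _ --> X](mulr0 ((eps / 2) ^- 2)); exact: cvgMr.
near=> N; rewrite measure_ge0/=.
have N0 : (0 < N)%N by near: N; exists 1%N.
apply: le_trans;
  last exact: (discovered_mass_chebyshev (hw _ N0) (hindep _ N0) (t N) eps20).
have mM := measurable_discovered_mass (w N) (T N) (t N).
apply: le_measure; rewrite ?inE.
- exact/(measurable_superlevel false)/measurable_fun_dist.
- exact/(measurable_superlevel true)/measurable_fun_dist.
- move=> x /= Mm; rewrite leNgt; apply/negP => MM.
  have mm : `|m - fine (mean_profile (w N) (T N) (t N))| < eps / 2.
    by near: N; exact: cvgr_dist_lt.
  have := ler_distD (fine (mean_profile (w N) (T N) (t N)))
    (discovered_mass (w N) (T N) (t N) x) m.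
  rewrite leNgt => /negP; apply; rewrite (lt_trans _ Mm)//.
  by rewrite [ltRHS]splitr ltrD// distrC.
Unshelve. all: end_near.
Qed.

Theorem theorem3p6 (R : realType) (lambda : R) (hlambda : 0 < lambda)
  (w p : forall N : nat, 'I_N -> R)
  (hw : forall N, (0 < N)%N -> positive_prob_vector (w N))
  (hp : forall N, (0 < N)%N -> positive_prob_vector (p N))
  (hdiffuse : \big[Num.max/0]_(i < N) w N i @[N --> \oo] --> (0 : R))
  (d : nat -> measure_display) (Omega : forall N, measurableType (d N))
  (P : forall N, probability (Omega N) R)
  (T : forall N, 'I_N -> {RV P N >-> R})
  (hindep : forall N, (0 < N)%N -> mutually_independent (T N))
  (hexp : forall N, (0 < N)%N ->
     forall i : 'I_N, has_exponential_law (lambda * p N i) (T N i))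
  (theta : R) (htheta0 : 0 < theta) (htheta1 : theta < 1)
  (a : nat -> R) (ha : forall N, (0 < N)%N -> 0 < a N)
  (F : R -> R)
  (hFrange : forall alpha, 0 <= alpha -> 0 <= F alpha < 1)
  (hFcont : {within `[0, +oo[, continuous F})
  (hFincr : forall alpha beta, 0 <= alpha -> alpha < beta -> F alpha < F beta)
  (hF0 : F 0 = 0)
  (hFlim : F alpha @[alpha --> +oo] --> (1 : R))
  (hmean : forall alpha, 0 <= alpha ->
     mean_profile (w N) (T N) (a N * alpha) @[N --> \oo] --> (F alpha)%:E) :
  exists2 alpha_theta : R,
    unique (fun alpha => 0 <= alpha /\ F alpha = theta) alpha_theta &
    cvg_in_probability P
      (fun N omega => quorum_time (w N) (T N) theta omega / a N) alpha_theta.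
Proof.
(* Right endpoint for the intermediate value theorem, available because [F] tends to 1 > [theta]. *)
have [b [b0 Fb]] : exists b, 0 <= b /\ theta < F b.
  near (@pinfty_nbhs R) => b; exists b; split; near: b.
    exact: nbhs_pinfty_ge.
  exact: cvgr_gt hFlim _ htheta1.
have [l] : exists2 l, l \in `[0, b] & F l = theta.
  apply: IVT => //.
    apply: continuous_subspaceW hFcont => x /=.
    by rewrite !in_itv/= => /andP[->].
  by rewrite ge_min le_max hF0 (ltW htheta0) (ltW Fb) orbT.
rewrite in_itv/= => /andP[l0 _] Fl.
(* Strict positivity ensures [v < l] below even when [v] is truncated to 0. *)
have {}l0 : 0 < l.
  rewrite lt_def l0 andbT; apply: contraTneq htheta0 => l00.
  by rewrite -Fl l00 hF0 ltxx.
exists l.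
  split=> [|x [x0 Fx]]; first by rewrite ltW.
  by have [/hFincr-/(_ (ltW l0))|/hFincr-/(_ x0)|//] := ltgtP l x;
    rewrite Fl Fx ltxx.
move=> eps eps0.
(* The truncation at 0 keeps [v] in the range where [hmean] applies. *)
pose u := l + eps; pose v := Num.max 0 (l - eps).
have u0 : 0 <= u by rewrite addr_ge0// ltW.
have v0 : 0 <= v by rewrite le_max lexx.
have Fu : theta < F u by rewrite -Fl hFincr ?ltrDl// ltW.
have Fv : F v < theta by rewrite -Fl hFincr// gt_max l0 ltrBlDr ltrDl.
have M_cvg (x : R) (x0 : 0 <= x) :=
  discovered_mass_cvg_probability hw hindep hdiffuse (hmean _ x0).
(* On {tau > a_N u} only M <= [theta] holds, so the deviation is at least [F u - theta]; halving
   makes it strict. On the other side M > [theta] is already strict. *)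
have du : 0 < (F u - theta) / 2 by rewrite divr_gt0// subr_gt0.
have dv : 0 < theta - F v by rewrite subr_gt0.
have adm00 : ((0 : \bar R) +? 0)%E by [].
(* Union bound: the probabilities of the two bad events have a sum tending to 0. *)
have := cvgeD (FF := eventually_filter) adm00
  (M_cvg _ u0 _ du) (M_cvg _ v0 _ dv).
rewrite adde0; apply: (@squeeze_cvge _ _ _ _ (cst 0%E)); last exact: cvg_cst.
near=> N; rewrite measure_ge0/=.
have N0 : (0 < N)%N by near: N; exists 1%N.
have aN0 := ha _ N0.
have mM t := measurable_discovered_mass (w N) (T N) t.
have mA t c e : measurable [set x | e < `|discovered_mass (w N) (T N) t x - c|].
  exact/(measurable_superlevel false)/measurable_fun_dist.
apply: le_trans (measureU2 _ _ _) => //.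
apply: le_measure; rewrite ?inE.
- apply/(measurable_superlevel false)/measurable_fun_dist/measurable_funM => //.
  exact: measurable_quorum_time (hw _ N0) htheta1.
- exact: measurableU.
move=> x /=; rewrite ltr_normr => /orP[tu|tv].
- left; rewrite distrC (lt_le_trans _ (ler_norm _))//.
  have : ~~ (quorum_time (w N) (T N) theta x <= a N * u).
    by rewrite -ltNge mulrC -ltr_pdivlMr// -ltrBrDl.
  rewrite quorum_time_le ?mulr_ge0 ?(ltW aN0)//; last exact: hw.
  by rewrite -leNgt; lra.
(* Here tau / a_N < [l - eps], which is at most [v], so the quorum is already exceeded at a_N v. *)
- right; rewrite (lt_le_trans _ (ler_norm _))// ltrBlDr subrK.
  rewrite -quorum_time_le ?mulr_ge0 ?(ltW aN0)//; last exact: hw.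
  rewrite [a N * v]mulrC -ler_pdivrMr// le_max; apply/orP; right; apply: ltW.
  by lra.
Unshelve. all: end_near.
Qed.
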